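(* Let $r\in\mathbb{N}$ be a positive integer, let $n\ge p\ge 1$, let $\Sigma$ be a (non-empty) germ at $0$ of a closed subset of $\mathbb{R}^n$ with $0\in\Sigma$, and let $f=(f_1,\dots,f_p):(\mathbb{R}^n,0)\to(\mathbb{R}^p,0)$ be a $C^r$ map-germ. Then the following conditions are equivalent: (1) There are strictly positive numbers $C,\alpha,\bar w$ such that $$\kappa(df(x))\ge C\,d(x,\Sigma)^{r-1}\quad\text{for all } x \text{ with } \|f(x)\|\le \bar w\, d(x,\Sigma)^r \text{ and } \|x\|<\alpha.$$ (2) The inequality $$d(x,\Sigma)\,\kappa(df(x))+\|f(x)\|\succsim d(x,\Sigma)^r$$ holds in some neighbourhood of $0\in\mathbb{R}^n$. (3) The inequality $$d(x,\Sigma)\left(\frac{\Gamma\big((\operatorname{grad} f_i(x))_{1\le i\le p}\big)}{\sum_{j=1}^p\Gamma\big((\operatorname{grad} f_i(x))_{i\ne j}\big)}\right)^{1/2}+\|f(x)\|\succsim d(x,\Sigma)^r$$ holds in some neighbourhood of $0\in\mathbb{R}^n$. (4) The inequality $$d(x,\Sigma)\,\|df^*(x)y\|+\|f(x)\|\succsim d(x,\Sigma)^r$$ holds for $x$ in some neighbourhood of $0\in\mathbb{R}^n$, uniformly for all $y\in\mathbb{S}^{p-1}$.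
   Context: $d(x,\Sigma)$ is the Euclidean distance from $x$ to $\Sigma$ (for a representative of the germ $\Sigma$). For vectors $v_1,\dots,v_p\in\mathbb{R}^n$ ($n\ge p$), the Kuo distance is $\kappa(v_1,\dots,v_p)=\min_i \operatorname{dist}(v_i,V_i)$, where $V_i$ is the linear span of the $v_j$ with $j\ne i$; for $p=1$, $\kappa(v)=\|v\|$. We write $\kappa(df(x))=\kappa(\operatorname{grad} f_1(x),\dots,\operatorname{grad} f_p(x))$. For non-negative functions $F,G$ defined near $0$, $F\succsim G$ in a neighbourhood of $0$ means that there are $K>0$ and $\rho>0$ with $G(x)\le K F(x)$ for all $\|x\|\le\rho$; ''uniformly for $y$'' means that the constant and the neighbourhood can be chosen independently of $y$. $\Gamma(v_1,\dots,v_k)=\det(\langle v_i,v_j\rangle)_{i,j\in\{1,\dots,k\}}$ is the Gram determinant; the Gram determinant of the empty family (occurring in the denominator when $p=1$) is $1$, and the quotient is taken to be $0$ when it is of the form $0/0$. $df^*(x):\mathbb{R}^p\to\mathbb{R}^n$ is the dual (adjoint) of the linear map $df(x)$, i.e. $df^*(x)y=\sum_{i=1}^p y_i\operatorname{grad} f_i(x)$. $\mathbb{S}^{p-1}$ is the unit sphere of $\mathbb{R}^p$ centred at $0$.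
   Formalization: In (1), when r = 1 and d(x,Σ) = 0, the expression d(x,Σ)^{r-1} = 0^0 is read as 0, so (1) demands nothing on Σ; with 0^0 = 1 the equivalence fails, e.g. for n = p = r = 1, Σ = ℝ, f = 0. *)

(* Defs.v *)
From HB Require Import structures.
From mathcomp Require Import all_boot all_order all_algebra.
From mathcomp Require Import boolp classical_sets functions reals topology.
From mathcomp Require Import normedtype derive.

Set Implicit Arguments.
Unset Strict Implicit.
Unset Printing Implicit Defensive.

Import Order.TTheory GRing.Theory Num.Theory.
Import numFieldNormedType.Exports.

Local Open Scope classical_set_scope.
Local Open Scope ring_scope.

Section Euclid.
Variables (R : realType) (n : nat).
Implicit Types (u v x : 'rV[R]_n) (A : set 'rV[R]_n).

Definition dot u v : R := \sum_(i < n) u 0 i * v 0 i.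

(* The library norm `|u| on 'rV[R]_n is the sup norm (it induces the same
   topology), hence this separate Euclidean norm. *)
Definition enorm u : R := Num.sqrt (dot u u).

Definition setdist x A : R := inf [set enorm (x - y) | y in A].

(* d(x, A)^k, with the convention 0^0 := 0 (whereas 0 ^+ 0 = 1). The convention
   is only felt for k = 0 and d(x, A) = 0; see [setdistXE]. *)
Definition setdistX x A (k : nat) : R :=
  if setdist x A == 0 then 0 else setdist x A ^+ k.

Lemma setdistXE x A k : setdist x A != 0 \/ (0 < k)%N ->
  setdistX x A k = setdist x A ^+ k.
Proof.
rewrite /setdistX; case: (eqVneq (setdist x A) 0) => [-> [//|k0]|//].
by rewrite expr0n; case: k k0.
Qed.

Definition sphere1 : set 'rV[R]_n := [set y | enorm y = 1].

End Euclid.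

Section Families.
Variables (R : realType) (n : nat).

(* A family v_1, ..., v_p of vectors of R^n is the matrix A : 'M[R]_(p, n) whose
   rows are the v_i; [row' i A] is the family with v_i omitted. *)

Definition lspan q (A : 'M[R]_(q, n)) : set 'rV[R]_n :=
  [set u : 'rV[R]_n | (u <= A)%MS].

(* For p >= 1 this is the infimum of a nonempty finite set, i.e. its minimum.
   For p = 1, [lspan (row' i A)] is {0}, so that kuo A is the norm of row 0 A. *)
Definition kuo p (A : 'M[R]_(p, n)) : R :=
  inf [set setdist (row i A) (lspan (row' i A)) | i in [set: 'I_p]].

(* \det of a 0 x 0 matrix is 1. *)
Definition gram q (A : 'M[R]_(q, n)) : R :=
  \det (\matrix_(i < q, j < q) dot (row i A) (row j A)).

(* 0 / 0 = 0 in a MathComp field. *)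
Definition gram_quotient p (A : 'M[R]_(p, n)) : R :=
  gram A / \sum_(j < p) gram (row' j A).

End Families.

Section Calculus.
Variables (R : realType) (n : nat).

Definition partial (j : 'I_n) (g : 'rV[R]_n -> R) (x : 'rV[R]_n) : R :=
  'D_(delta_mx 0 j) g x.

(* All iterated partial derivatives of order <= k exist and are continuous
   on U. *)
Fixpoint Ck (k : nat) (U : set 'rV[R]_n) (g : 'rV[R]_n -> R) : Prop :=
  (forall x, U x -> {for x, continuous g}) /\
  match k with
  | 0 => True
  | k'.+1 => forall j : 'I_n,
      (forall x, U x -> derivable g x (delta_mx 0 j)) /\ Ck k' U (partial j g)
  end.

(* f is a representative of a C^r map-germ (R^n, 0) -> (R^p, 0); its values
   outside a neighbourhood of 0 are arbitrary. *)
Definition Cr_germ0 p (r : nat) (f : 'rV[R]_n -> 'rV[R]_p) : Prop :=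
  f 0 = 0 /\
  exists U : set 'rV[R]_n,
    [/\ open U, U 0 & forall i : 'I_p, Ck r U (fun x => f x 0 i)].

Definition grad (g : 'rV[R]_n -> R) (x : 'rV[R]_n) : 'rV[R]_n :=
  \row_(j < n) partial j g x.

Definition grads p (f : 'rV[R]_n -> 'rV[R]_p) (x : 'rV[R]_n) : 'M[R]_(p, n) :=
  \matrix_(i < p) grad (fun z => f z 0 i) x.

(* df^*(x) y *)
Definition dual_diff p (f : 'rV[R]_n -> 'rV[R]_p) (x : 'rV[R]_n)
    (y : 'rV[R]_p) : 'rV[R]_n :=
  \sum_(i < p) y 0 i *: grad (fun z => f z 0 i) x.

Definition succsim (F G : 'rV[R]_n -> R) : Prop :=
  exists K rho : R, [/\ 0 < K, 0 < rho &
    forall x, enorm x <= rho -> G x <= K * F x].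

Definition succsim_unif (T : Type) (Y : set T) (F : T -> 'rV[R]_n -> R)
    (G : 'rV[R]_n -> R) : Prop :=
  exists K rho : R, [/\ 0 < K, 0 < rho &
    forall y, Y y -> forall x, enorm x <= rho -> G x <= K * F y x].

End Calculus.

(* Main.v *)
Require Import Defs.
From mathcomp Require Import all_boot all_order all_algebra.
From mathcomp Require Import boolp classical_sets functions reals topology.
From mathcomp Require Import normedtype derive.
From mathcomp Require Import ring lra.

Import Order.TTheory GRing.Theory Num.Theory.
Import numFieldNormedType.Exports.

Local Open Scope classical_set_scope.
Local Open Scope ring_scope.

(** Only linear algebra at a fixed point [x] matters.  Let the rows of [A] be
    the gradients [v_i] at [x], so that [df^*(x) y = y *m A].  Up to factors
    that depend on [p] only, [kuo(A)], the minimum of [|y A|] over unit vectors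
    [y] and the square root of the Gram quotient are the same quantity:
    - [y_i^2 kuo(A)^2 <= |y A|^2] for every [y] and [i] ([kuo_le_comb]), since
      [y A / y_i] is [v_i] minus an element of the span of the other [v_j];
    - conversely a lower bound of [|y A|] on the unit sphere is a lower bound
      of [kuo(A)] ([le_kuo]), since [v_i - u], for [u] in that span, is [y A]
      for some [y] with [y_i = 1], hence with [|y| >= 1].

    For the Gram quotient, assume that [G = A A^T] is invertible.  The vectors
    [w_i = e_i G^-1 A] form the family dual to [(v_i)]: [<y A, w_i> = y_i] and
    [|w_i|^2 = (G^-1)_ii].  By Cramer's rule the Gram quotient is the inverse
    of the trace of [G^-1] ([gram_quotientE]).  Cauchy-Schwarz gives
    [y_i^2 <= |y A|^2 (G^-1)_ii]; summing over [i], the Gram quotient is at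
    most [|y A|^2] on the unit sphere ([gram_quotient_le]).  Applying
    [kuo_le_comb] to [w_i] gives [kuo(A)^2 (G^-1)_ii <= 1]; summing over [i],
    [kuo(A)^2] is at most [p] times the Gram quotient
    ([kuo_le_gram_quotient]).  If [G] is singular, both the Gram quotient and
    [kuo(A)] vanish.

    Hence (2) -> (3) -> (4).  For (1) -> (2), at each [x] either [|f(x)|]
    exceeds [w d(x)^r] or (1) bounds [kuo] from below.  For (4) -> (1),
    let [K] be the constant in (4).  With [w = 1 / (2 K)], the term
    [d(x) |df^*(x) y|] is at least [d(x)^r / (2 K)], and [le_kuo] concludes
    after division by [d(x)]. *)

(** * Euclidean norm and distance to a set *)

Section Euclidean.
Context {R : realType} {n : nat}.
Implicit Types (u v x : 'rV[R]_n) (A : set 'rV[R]_n).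

Lemma dotE u v : dot u v = (u *m v^T) 0 0.
Proof. by rewrite mxE /dot; apply: eq_bigr => i _; rewrite mxE. Qed.

Lemma dotC u v : dot u v = dot v u.
Proof. by rewrite /dot; apply: eq_bigr => i _; rewrite mulrC. Qed.

Lemma dotDl u v x : dot (u + v) x = dot u x + dot v x.
Proof. by rewrite !dotE mulmxDl mxE. Qed.

Lemma dotZl a u v : dot (a *: u) v = a * dot u v.
Proof. by rewrite !dotE -scalemxAl mxE. Qed.

Lemma dot_ge0 u : 0 <= dot u u.
Proof. by apply: sumr_ge0 => i _; rewrite -expr2 sqr_ge0. Qed.

Lemma dot_eq0 u : dot u u = 0 -> u = 0.
Proof.
move/eqP; rewrite /dot psumr_eq0 => [/allP u0|i _]; last first.
  by rewrite -expr2 sqr_ge0.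
apply/rowP => i; rewrite mxE; apply/eqP.
by have := u0 i; rewrite mem_index_enum mulf_eq0 orbb; apply.
Qed.

Lemma enorm_ge0 u : 0 <= enorm u.
Proof. exact: sqrtr_ge0. Qed.

Lemma enorm_sqr u : enorm u ^+ 2 = dot u u.
Proof. by rewrite sqr_sqrtr ?dot_ge0. Qed.

Lemma enormZ a u : 0 <= a -> enorm (a *: u) = a * enorm u.
Proof.
move=> a0; rewrite /enorm dotZl dotC dotZl mulrA -expr2.
by rewrite sqrtrM ?sqr_ge0// sqrtr_sqr ger0_norm.
Qed.

Lemma dot_CauchySchwarz u v : dot u v ^+ 2 <= dot u u * dot v v.
Proof.
have [v0|vn0] := eqVneq (dot v v) 0.
  rewrite v0 mulr0 (dot_eq0 _ v0) dotC.
  by rewrite -(scale0r (0 : 'rV[R]_n)) dotZl mul0r expr0n.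
have v_gt0 : 0 < dot v v by rewrite lt_def vn0 dot_ge0.
(* The component of [u] orthogonal to [v], cleared of denominators. *)
have := dot_ge0 (dot v v *: u + (- dot u v) *: v).
rewrite dotDl !dotZl (dotC u) (dotC v (_ + _)) !dotDl !dotZl (dotC v u).
rewrite [X in 0 <= X -> _](_ : _ =
  dot v v * (dot u u * dot v v - dot u v ^+ 2)); last by ring.
by rewrite pmulr_rge0// subr_ge0.
Qed.

Lemma setdist_ge0 x A : 0 <= setdist x A.
Proof.
rewrite /setdist.
have [->|/set0P[y Ay]] := eqVneq A set0; first by rewrite image_set0 inf0.
apply: lb_le_inf; first by exists (enorm (x - y)); exists y.
by move=> _ [z _ <-]; exact: enorm_ge0.
Qed.

Lemma setdist_le x y A : A y -> setdist x A <= enorm (x - y).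
Proof.
move=> Ay; apply: ge_inf; last by exists y.
by exists 0 => _ [z _ <-]; exact: enorm_ge0.
Qed.

Lemma le_setdist c x A : A !=set0 -> (forall y, A y -> c <= enorm (x - y)) ->
  c <= setdist x A.
Proof.
move=> [y Ay] cA; apply: lb_le_inf; first by exists (enorm (x - y)); exists y.
by move=> _ [z Az <-]; exact: cA.
Qed.

End Euclidean.

(** * Linear combinations of a family and its Kuo distance *)

Section Kuo.
Context {R : realType} {p n : nat}.
Implicit Types (A : 'M[R]_(p, n)) (y : 'rV[R]_p).

(** The span of the rows other than the [i]-th consists of the combinations of
    all the rows whose [i]-th coefficient is zero. *)
Lemma lspan_row'P A i u :
  lspan (row' i A) u <-> exists2 y : 'rV[R]_p, y 0 i = 0 & u = y *m A.
Proof.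
split=> [/submxP[z ->]|[y yi0 ->]].
  exists (z *m row' i 1%:M); last by rewrite -mulmxA -rowsubE row'Esub.
  rewrite mxE big1// => j _.
  by rewrite !mxE eq_sym (negbTE (neq_lift i j)) mulr0.
rewrite /lspan /= mulmx_sum_row; apply: summx_sub => j _.
case: (unliftP i j) => [k ->|->]; last by rewrite yi0 scale0r sub0mx.
by rewrite scalemx_sub// -row_rowsub -row'Esub row_sub.
Qed.

Lemma kuo_ge0 A : (0 < p)%N -> 0 <= kuo A.
Proof.
move=> p0; apply: lb_le_inf.
  by exists (setdist (row (Ordinal p0) A) (lspan (row' (Ordinal p0) A)));
     exists (Ordinal p0).
by move=> _ [i _ <-]; exact: setdist_ge0.
Qed.

Lemma kuo_le A i : kuo A <= setdist (row i A) (lspan (row' i A)).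
Proof.
apply: ge_inf; last by exists i.
by exists 0 => _ [j _ <-]; exact: setdist_ge0.
Qed.

(** The Kuo distance bounds linear combinations of the family from below. *)
Lemma kuo_le_comb A y i : y 0 i ^+ 2 * kuo A ^+ 2 <= dot (y *m A) (y *m A).
Proof.
have [->|yi0] := eqVneq (y 0 i) 0; first by rewrite expr0n mul0r dot_ge0.
have p0 : (0 < p)%N := leq_ltn_trans (leq0n i) (ltn_ord i).
have /= dist_le : kuo A <= enorm ((y 0 i)^-1 *: (y *m A)).
  apply: le_trans (kuo_le A i) _.
  (* [z] is chosen so that [e_i - z = y / y_i], whence [z 0 i = 0]. *)
  set z : 'rV[R]_p := delta_mx 0 i - (y 0 i)^-1 *: y.
  have Sz : lspan (row' i A) (z *m A).
    by apply/lspan_row'P; exists z => //; rewrite !mxE !eqxx mulVf// subrr.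
  apply: le_trans (setdist_le _ _ _ Sz) _.
  by rewrite mulmxBl -rowE -scalemxAl opprB addrC subrK.
have : kuo A ^+ 2 <= enorm ((y 0 i)^-1 *: (y *m A)) ^+ 2.
  by rewrite ler_sqr// nnegrE ?kuo_ge0 ?enorm_ge0.
rewrite enorm_sqr dotZl dotC dotZl mulrA -expr2 exprVn mulrC.
by rewrite ler_pdivlMr ?exprn_even_gt0// mulrC.
Qed.

(** The Kuo distance is at least the minimum of [|y A|] over unit vectors
    [y]. *)
Lemma le_kuo A c : (0 < p)%N -> 0 <= c ->
  (forall y, sphere1 y -> c <= enorm (y *m A)) -> c <= kuo A.
Proof.
move=> p0 c0 cA; apply: lb_le_inf.
  by exists (setdist (row (Ordinal p0) A) (lspan (row' (Ordinal p0) A)));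
     exists (Ordinal p0).
move=> _ [i _ <-]; apply: le_setdist; first by exists 0; exact: sub0mx.
move=> u /lspan_row'P[z zi0 ->].
set y : 'rV[R]_p := delta_mx 0 i - z.
have -> : row i A - z *m A = y *m A by rewrite mulmxBl -rowE.
have y_ge1 : 1 <= enorm y.
  rewrite -(ler_sqr (x := 1)) ?nnegrE ?enorm_ge0// expr1n enorm_sqr.
  rewrite /dot (bigD1 i)//= !mxE !eqxx zi0 subr0 mul1r lerDl.
  by apply: sumr_ge0 => j _; rewrite -expr2 sqr_ge0.
have y_gt0 : 0 < enorm y := lt_le_trans ltr01 y_ge1.
have yV0 : 0 <= (enorm y)^-1 by rewrite invr_ge0 ltW.
have := cA ((enorm y)^-1 *: y).
rewrite /sphere1/= enormZ// mulVf ?gt_eqF// -scalemxAl enormZ// => /(_ erefl).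
rewrite mulrC ler_pdivlMr//; apply: le_trans.
by rewrite ler_peMr.
Qed.

End Kuo.

(** * Gram determinants *)

Section Gram.
Context {R : realType} {p n : nat}.
Implicit Types (A : 'M[R]_(p, n)) (y : 'rV[R]_p).

Lemma gramE q (A : 'M[R]_(q, n)) : gram A = \det (A *m A^T).
Proof.
by congr (\det _); apply/matrixP => i j; rewrite !mxE; apply: eq_bigr => k _;
  rewrite !mxE.
Qed.

Lemma gram_row' A i : gram (row' i A) = cofactor (A *m A^T) i i.
Proof.
rewrite gramE /cofactor addnn -signr_odd odd_double expr0 mul1r.
congr (\det _); apply/matrixP => j k; rewrite !mxE.
by apply: eq_bigr => l _; rewrite !mxE.
Qed.

(** Cramer's rule: the Gram determinant of the family without its [i]-th vector
    is the [i]-th diagonal entry of the adjugate of the Gram matrix. *)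
Lemma gram_quotientE A : gram A != 0 ->
  gram_quotient A = (\sum_i invmx (A *m A^T) i i)^-1.
Proof.
rewrite gramE => G0; rewrite /gram_quotient -[LHS]invrK invf_div; congr _^-1.
rewrite mulr_suml; apply: eq_bigr => i _.
by rewrite gram_row' gramE /invmx unitmxE unitfE G0 !mxE mulrC.
Qed.

(** The [i]-th vector of the family dual to the rows of [A] inside their span.
    This is meaningful only when the Gram matrix of [A] is invertible. *)
Definition dual_row A (i : 'I_p) : 'rV[R]_n := row i (invmx (A *m A^T)) *m A.

Lemma dot_dual_row A y i : gram A != 0 -> dot (y *m A) (dual_row A i) = y 0 i.
Proof.
rewrite gramE -unitfE -unitmxE => Gu.
rewrite dotC dotE /dual_row trmx_mul mulmxA -(mulmxA _ A) -row_mul mulVmx//.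
by rewrite row1 -rowE !mxE.
Qed.

Lemma dot_dual_rowE A i : gram A != 0 ->
  dot (dual_row A i) (dual_row A i) = invmx (A *m A^T) i i.
Proof. by move=> G0; rewrite {1}/dual_row dot_dual_row// mxE. Qed.

Lemma invgram_diag_ge0 A i : gram A != 0 -> 0 <= invmx (A *m A^T) i i.
Proof. by move=> G0; rewrite -dot_dual_rowE// dot_ge0. Qed.

Lemma gram_quotient_le A y : sphere1 y ->
  gram_quotient A <= dot (y *m A) (y *m A).
Proof.
rewrite /sphere1/= => y1.
have [G0|G0] := eqVneq (gram A) 0.
  by rewrite /gram_quotient G0 mul0r dot_ge0.
rewrite gram_quotientE//; set S := \sum_i _.
have le1 : 1 <= dot (y *m A) (y *m A) * S.
  rewrite -(expr1n R 2) -y1 enorm_sqr mulr_sumr; apply: ler_sum => i _.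
  rewrite -expr2 -(dot_dual_row A y i G0) -(dot_dual_rowE A i G0).
  exact: dot_CauchySchwarz.
have S_gt0 : 0 < S.
  rewrite lt_def sumr_ge0 ?andbT => [|i _]; last exact: invgram_diag_ge0.
  by apply/eqP => S0; move: le1; rewrite S0 mulr0 ler10.
by rewrite -[X in X <= _]mul1r ler_pdivrMr.
Qed.

Lemma kuo_le_gram_quotient A : (0 < p)%N ->
  kuo A ^+ 2 <= p%:R * gram_quotient A.
Proof.
move=> p0; have [G0|G0] := eqVneq (gram A) 0.
  (* A non-trivial linear relation between the rows forces [kuo A = 0]. *)
  rewrite /gram_quotient G0 mul0r mulr0.
  have /det0P[y yn0 yG0] : \det (A *m A^T) == 0 by rewrite -gramE G0.
  have yA0 : dot (y *m A) (y *m A) = 0.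
    by rewrite dotE trmx_mul mulmxA -(mulmxA y) yG0 mul0mx mxE.
  have /rV0Pn[i yi0] := yn0.
  have := kuo_le_comb A y i; rewrite yA0 pmulr_rle0//.
  by rewrite exprn_even_gt0.
have kuo_diag i : kuo A ^+ 2 * invmx (A *m A^T) i i <= 1.
  have := invgram_diag_ge0 A i G0; rewrite le_eqVlt => /predU1P[<-|g_gt0].
    by rewrite mulr0.
  (* The combination here is [dual_row A i]: its [i]-th coefficient and its
     squared norm are both the [i]-th diagonal entry of the inverse. *)
  have := kuo_le_comb A (row i (invmx (A *m A^T))) i.
  rewrite -/(dual_row A i) dot_dual_rowE// mxE mulrC expr2 mulrA.
  by rewrite ger_pMl.
have S_ge0 : 0 <= \sum_i invmx (A *m A^T) i i.
  by apply: sumr_ge0 => i _; exact: invgram_diag_ge0.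
rewrite gram_quotientE//; move: S_ge0; rewrite le_eqVlt => /predU1P[S0|S_gt0].
  (* The trace cannot vanish: all the dual vectors would be zero, although each
     has inner product 1 with the corresponding row. *)
  have i := Ordinal p0.
  have g0 : invmx (A *m A^T) i i = 0.
    apply/eqP; move/esym/eqP: S0; rewrite psumr_eq0 => [/allP/(_ i)|j _].
      by rewrite mem_index_enum; exact.
    exact: invgram_diag_ge0.
  have w0 : dual_row A i = 0 by apply: dot_eq0; rewrite dot_dual_rowE.
  have := dot_dual_row A (delta_mx 0 i) i G0.
  rewrite w0 dotC -(scale0r (0 : 'rV[R]_n)) dotZl mul0r !mxE !eqxx => /eqP.
  by rewrite eq_sym oner_eq0.
rewrite ler_pdivlMr// mulr_sumr -[X in _ <= X%:R](card_ord p).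
rewrite -sum1_card natr_sum.
by apply: ler_sum => i _; exact: kuo_diag.
Qed.

End Gram.

Lemma dual_diffE (R : realType) (n p : nat) (f : 'rV[R]_n -> 'rV[R]_p) x y :
  dual_diff f x y = y *m grads f x.
Proof. by rewrite mulmx_sum_row; apply: eq_bigr => i _; rewrite rowK. Qed.

(** * Equivalence of the four conditions *)

Theorem theorem4p5 (R : realType) (r n p : nat)
    (Sigma : set 'rV[R]_n) (f : 'rV[R]_n -> 'rV[R]_p) :
  (0 < r)%N -> (0 < p)%N -> (p <= n)%N ->
  closed Sigma -> Sigma 0 -> Cr_germ0 r f ->
  [<->
    exists C alpha w : R, [/\ 0 < C, 0 < alpha, 0 < w &
      forall x : 'rV[R]_n,
        enorm (f x) <= w * setdist x Sigma ^+ r -> enorm x < alpha ->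
        C * setdistX x Sigma r.-1 <= kuo (grads f x)];
    succsim
      (fun x => setdist x Sigma * kuo (grads f x) + enorm (f x))
      (fun x => setdist x Sigma ^+ r);
    succsim
      (fun x => setdist x Sigma * Num.sqrt (gram_quotient (grads f x))
                + enorm (f x))
      (fun x => setdist x Sigma ^+ r);
    succsim_unif (@sphere1 R p)
      (fun y x => setdist x Sigma * enorm (dual_diff f x y) + enorm (f x))
      (fun x => setdist x Sigma ^+ r)].
Proof.
move=> r0 p0 _ _ _ _; set d := fun x => setdist x Sigma.
have d_ge0 x : 0 <= d x by exact: setdist_ge0.
tfae.
- (* Condition (2) uses a closed ball and (1) an open one: halve [alpha]. *)
  move=> [C [alpha [w [C0 alpha0 w0 H]]]].
  exists (C^-1 + w^-1), (alpha / 2); split; [|lra|].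
    by rewrite addr_gt0 ?invr_gt0.
  move=> x xa; have k0 := kuo_ge0 (grads f x) p0; have e0 := enorm_ge0 (f x).
  have a_ge0 : 0 <= d x * kuo (grads f x) by rewrite mulr_ge0.
  have CV0 : 0 < C^-1 by rewrite invr_gt0.
  have wV0 : 0 < w^-1 by rewrite invr_gt0.
  rewrite -/(d x).
  have [fx|fx] := leP (enorm (f x)) (w * d x ^+ r).
    have := H x fx ltac:(lra) => Hk.
    have : C * d x ^+ r <= d x * kuo (grads f x).
      have [d0|dn0] := eqVneq (d x) 0.
        by rewrite d0 expr0n gtn_eqF// mulr0 mul0r.
      move: Hk; rewrite setdistXE; last by left.
      rewrite -/(d x) => /(ler_wpM2l (d_ge0 x)); apply: le_trans.
      by rewrite mulrCA -exprS prednK.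
    rewrite mulrC -ler_pdivlMr// mulrC => h.
    by nra.
  have : d x ^+ r <= w^-1 * enorm (f x) by rewrite ler_pdivlMl// ltW.
  by nra.
- move=> [K [rho [K0 rho0 H]]].
  exists (K * (Num.sqrt p%:R + 1)), rho.
  have s0 : 0 <= Num.sqrt p%:R :> R by exact: sqrtr_ge0.
  split=> //; first by rewrite mulr_gt0//; lra.
  move=> x /H; move/le_trans; apply.
  rewrite -mulrA ler_pM2l//; have e0 := enorm_ge0 (f x).
  set q := Num.sqrt (gram_quotient _).
  have q0 : 0 <= q by exact: sqrtr_ge0.
  have kq : kuo (grads f x) <= Num.sqrt p%:R * q.
    rewrite -sqrtrM ?ler0n// -[leLHS]ger0_norm ?kuo_ge0// -sqrtr_sqr.
    by apply: ler_wsqrtr; exact: kuo_le_gram_quotient.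
  have := ler_wpM2l (d_ge0 x) kq; rewrite -/(d x).
  have := mulr_ge0 (d_ge0 x) q0; have := mulr_ge0 s0 e0.
  by nra.
- move=> [K [rho [K0 rho0 H]]].
  exists K, rho; split=> // y y1 x /H; move/le_trans; apply.
  rewrite ler_pM2l// lerD2r ler_wpM2l//; first exact: d_ge0.
  rewrite /= dual_diffE; apply: ler_wsqrtr; exact: gram_quotient_le.
- move=> [K [rho [K0 rho0 H]]].
  (* With [w = 1 / (2 K)], on the horn neighbourhood [|f x| <= w d(x)^r] at
     least half of [d(x)^r / K] is left for [d(x) |df^*(x) y|]. *)
  have KV0 : 0 < K^-1 by rewrite invr_gt0.
  exists (K^-1 / 2), rho, (K^-1 / 2); split=> //; [lra|lra|].
  move=> x fx xrho; have [d0|dn0] := eqVneq (d x) 0.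
    by rewrite /setdistX -/(d x) d0 eqxx mulr0 kuo_ge0.
  have d_gt0 : 0 < d x by rewrite lt_def dn0 d_ge0.
  rewrite setdistXE; last by left.
  rewrite -/(d x); apply: le_kuo => //.
    by rewrite mulr_ge0 ?exprn_ge0//; lra.
  move=> y y1; have := H y y1 x (ltW xrho); rewrite /= dual_diffE.
  rewrite -ler_pdivrMl// -/(d x) => Hy.
  rewrite -(ler_pM2l d_gt0) mulrCA -exprS prednK//.
  move: fx; rewrite -/(d x); lra.
Qed.
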